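(* Let $\bm{\Gamma}\in\mathbb{S}^{N\times N}_{++}$ and $\rho=\max_{i,j}|(\bm{\Gamma}^{-1}\bm{\Gamma}^{-1})_{i,j}|$. For some $\beta>0$ and $\tau>0$ let $$\mathcal{K}=\{\bm{W}\in\mathbb{S}^{N\times N}_{++}:\ \|\mathrm{vec}(\bm{W})\|_\infty\le\beta,\ \mathrm{Tr}(\bm{\Gamma}\bm{W}\bm{\Gamma})\le\tau\},$$ and for some $g>0$ let $$\mathcal{L}\subseteq\{\bm{L}\in\mathbb{S}^{N\times N}_{+}:\ \textstyle\sum_{i,j}|\bm{L}_{i,j}|\le g\}.$$ Let $\epsilon>0$ and $\eta>0$. Then for any competitor matrix $\bm{W}^*\in\mathcal{K}$, the FTRL algorithm with the generalised log-determinant regularizer $R(\bm{X})=-\ln\det(\bm{\Gamma}\bm{X}\bm{\Gamma}+\epsilon\bm{E})$ achieves $$\mathrm{Regret}_{\mathrm{OSDP}}(T,\mathcal{K},\mathcal{L},\bm{W}^* )=O\left(g^2(\beta+\rho\epsilon)^2T\eta+\frac{\tau}{\epsilon\eta}\right).$$ In particular, with $\eta=\sqrt{\dfrac{\tau}{g^2(\beta+\rho\epsilon)^2\epsilon T}}$, $$\mathrm{Regret}_{\mathrm{OSDP}}(T,\mathcal{K},\mathcal{L},\bm{W}^* )\le O\left(\sqrt{g^2(\beta+\rho\epsilon)^2\tau T/\epsilon}\right).$$ Here $O(\cdot)$ hides an absolute constant.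
   Context: $\mathbb{S}^{N\times N}_{+}$ and $\mathbb{S}^{N\times N}_{++}$ denote the real symmetric positive semi-definite and the real symmetric strictly positive definite $N\times N$ matrices; $\bm{E}$ is the identity matrix; $\bm{A}\bullet\bm{B}=\sum_{i,j}\bm{A}_{i,j}\bm{B}_{i,j}$ is the Frobenius inner product; $\|\mathrm{vec}(\bm{W})\|_\infty=\max_{i,j}|\bm{W}_{i,j}|$. Generalised online semi-definite programming (OSDP) problem $(\mathcal{K},\mathcal{L})$: in each round $t=1,\dots,T$ the algorithm chooses $\bm{W}_t\in\mathcal{K}$, then the adversary gives $\bm{L}_t\in\mathcal{L}$, and the algorithm incurs the loss $\bm{W}_t\bullet\bm{L}_t$. The regret with respect to a competitor $\bm{W}^*$ is $\mathrm{Regret}_{\mathrm{OSDP}}(T,\mathcal{K},\mathcal{L},\bm{W}^* )=\sum_{t=1}^T(\bm{W}_t-\bm{W}^* )\bullet\bm{L}_t$. The bound is claimed for every sequence of loss matrices in $\mathcal{L}$. The FTRL (follow-the-regularized-leader) algorithm with regularizer $R$ and parameter $\eta>0$ chooses in each round $t$ $$\bm{W}_t\in\arg\min_{\bm{W}\in\mathcal{K}}\left(R(\bm{W})+\eta\sum_{s=1}^{t-1}\bm{L}_s\bullet\bm{W}\right).$$ *)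

(* Defs.v *)
From mathcomp Require Export all_boot all_order all_algebra.
From mathcomp Require Export classical_sets reals normedtype exp.

Set Implicit Arguments.
Unset Strict Implicit.
Unset Printing Implicit Defensive.

Import Order.TTheory GRing.Theory Num.Theory.

Local Open Scope classical_set_scope.
Local Open Scope ring_scope.

Definition psdmx (R : realType) (N : nat) (A : 'M[R]_N) : Prop :=
  A^T = A /\ forall x : 'cV[R]_N, 0 <= (x^T *m A *m x) 0 0.

Definition pdmx (R : realType) (N : nat) (A : 'M[R]_N) : Prop :=
  A^T = A /\ forall x : 'cV[R]_N, x != 0 -> 0 < (x^T *m A *m x) 0 0.

Definition frobenius (R : realType) (N : nat) (A B : 'M[R]_N) : R :=
  \sum_i \sum_j A i j * B i j.

(* [mx_norm] is the entrywise maximum norm, [max_(i,j) `|A i j|]. *)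
Definition feasible (R : realType) (N : nat) (Gamma : 'M[R]_N) (beta tau : R) :
    set 'M[R]_N :=
  [set W | [/\ pdmx W, mx_norm W <= beta & \tr (Gamma *m W *m Gamma) <= tau]].

Definition losses (R : realType) (N : nat) (g : R) : set 'M[R]_N :=
  [set L | psdmx L /\ \sum_i \sum_j `|L i j| <= g].

Definition logdet_reg (R : realType) (N : nat) (Gamma : 'M[R]_N) (eps : R)
    (X : 'M[R]_N) : R :=
  - ln (\det (Gamma *m X *m Gamma + eps%:M)).

Definition argmin (R : realType) (U : Type) (K : set U) (F : U -> R) : set U :=
  [set x | K x /\ forall y, K y -> F x <= F y].

(* Rounds are numbered from 1 to T; the values of the sequences outside this
   range are irrelevant. The set of minimizers over K may be empty, since K need
   not be closed, and need not be a singleton for a general regularizer: the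
   predicate says that W is a possible run of the algorithm against L. *)
Definition FTRL (R : realType) (N : nat) (K : set 'M[R]_N)
    (reg : 'M[R]_N -> R) (eta : R) (T : nat) (L W : nat -> 'M[R]_N) : Prop :=
  forall t : nat, (1 <= t <= T)%N ->
    argmin K (fun V => reg V + eta * \sum_(1 <= s < t) frobenius (L s) V) (W t).

Definition regret (R : realType) (N : nat) (T : nat) (L W : nat -> 'M[R]_N)
    (Wstar : 'M[R]_N) : R :=
  \sum_(1 <= t < T.+1) frobenius (W t - Wstar) (L t).

(* Main.v *)
Require Import Defs.
From mathcomp Require Import all_boot all_order all_algebra.
From mathcomp Require Import classical_sets reals normedtype exp.
From mathcomp Require Import ring lra.
Set Implicit Arguments.
Unset Strict Implicit.
Unset Printing Implicit Defensive.
Import Order.TTheory GRing.Theory Num.Theory.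
Local Open Scope classical_set_scope.
Local Open Scope ring_scope.

(** Put G = Gamma^-1 Gamma^-1 and A(W) = W + eps G.  Since
    Gamma W Gamma + eps = Gamma A(W) Gamma, the regularizer is, up to a constant,
    - ln det A(W) ([logdet_reg_shift]), and on the feasible set the entries of
    A(W) are at most b = beta + rho eps in absolute value.  So everything reduces
    to - ln det on positive definite matrices, for which two estimates suffice:
    the tangent bound [ln_det_tangent], expressing that ln det is concave, and a
    second-order lower bound [ln_det_quadratic] valid when the increment S of A
    satisfies S >= - A / 4.

    One round.  Let A = A(W_t), let B = A(V) for another feasible V, and let S_t
    be the sum of the past losses.  Minimality of W_t along the segment from W_t
    to V, together with [ln_det_quadratic], gives the first-order condition
    tr (A^-1 (B - A)) <= eta S_t . (V - W_t) ([first_order_optimality]).  Hence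
    the objective of the next round, evaluated at V, exceeds its value at W_t by
    at least
      ln det A - ln det B + tr (A^-1 (B - A)) + eta tr (L_t (B - A)).
    The tangent bound at the unconstrained minimizer H^-1, H = A^-1 + eta L_t,
    removes B and leaves ln det H - ln det A^-1 - eta tr (A L_t), which
    [ln_det_quadratic], now used at A^-1, bounds below by
    - 2 eta^2 tr (A L_t A L_t) ([logdet_stability]).  Finally
    tr (A L A L) <= b^2 g^2, by bounding every entry of A by b
    ([trace_mul_sqr_le]).

    All rounds.  Chaining these inequalities ([ftrl_regret_le]) bounds the regret
    by (R(Wstar) - R(W_1)) / eta + 2 eta T b^2 g^2.  Two more tangent bounds, through
    the matrix eps E, give R(Wstar) - R(W_1) <= tau / eps ([logdet_diameter]).  So
    the constant 2 works in the first bound; the stated step size makes the two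
    terms g^2 b^2 T eta and tau / (eps eta) equal to the square root of their
    product, and the constant 3 covers the second bound.

    Both matrix estimates avoid spectral theory: they follow from the Cholesky
    factorisation and from an induction on the size by Schur complements. *)

(** * Quadratic forms and semidefinite matrices *)

Definition quad (R : realType) (n : nat) (A : 'M[R]_n) (x : 'cV[R]_n) : R :=
  (x^T *m A *m x) 0 0.

Section LogDeterminant.
Variable R : realType.
Implicit Types n : nat.

Lemma quadD n (A B : 'M[R]_n) x : quad (A + B) x = quad A x + quad B x.
Proof. by rewrite /quad mulmxDr mulmxDl mxE. Qed.

Lemma quadZ n (A : 'M[R]_n) c x : quad (c *: A) x = c * quad A x.
Proof. by rewrite /quad -scalemxAr -scalemxAl mxE. Qed.

Lemma quad_congr n (A C : 'M[R]_n) x : quad (C^T *m A *m C) x = quad A (C *m x).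
Proof. by rewrite /quad trmx_mul !mulmxA. Qed.

Lemma dotmxC n (x y : 'cV[R]_n) : (x^T *m y) 0 0 = (y^T *m x) 0 0.
Proof. by rewrite !mxE; apply: eq_bigr => i _; rewrite !mxE mulrC. Qed.

Lemma quad_outer n (v x : 'cV[R]_n) : quad (v *m v^T) x = (v^T *m x) 0 0 ^+ 2.
Proof.
by rewrite /quad mulmxA -mulmxA mxE big_ord1 expr2 dotmxC.
Qed.

Lemma quad1 n (x : 'cV[R]_n) : quad 1%:M x = \sum_i x i 0 ^+ 2.
Proof. by rewrite /quad mulmx1 mxE; apply: eq_bigr => i _; rewrite mxE expr2. Qed.

Lemma quad1_gt0 n (x : 'cV[R]_n) : x != 0 -> 0 < quad 1%:M x.
Proof.
move=> x0; rewrite quad1 lt0r sumr_ge0 ?andbT => [|i _]; last exact: sqr_ge0.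
apply: contra x0 => /eqP/psumr_eq0P x0; apply/eqP/colP => i; rewrite mxE.
by apply/eqP; rewrite -sqrf_eq0 x0// => j _; exact: sqr_ge0.
Qed.

Lemma quad_delta n (A : 'M[R]_n) i : quad A (delta_mx i 0) = A i i.
Proof. by rewrite /quad trmx_delta -rowE -colE !mxE. Qed.

Lemma pdmx_psd n (A : 'M[R]_n) : pdmx A -> psdmx A.
Proof.
move=> [As Ap]; split=> // x; have [->|/Ap/ltW//] := eqVneq x 0.
by rewrite mulmx0 !mxE.
Qed.

Lemma psdmxD n (A B : 'M[R]_n) : psdmx A -> psdmx B -> psdmx (A + B).
Proof.
move=> [As Ap] [Bs Bp]; split; first by rewrite linearD /= As Bs.
by move=> x; rewrite -/(quad _ _) quadD; apply: addr_ge0; [exact: Ap | exact: Bp].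
Qed.

Lemma psdmxZ n c (A : 'M[R]_n) : 0 <= c -> psdmx A -> psdmx (c *: A).
Proof.
move=> c0 [As Ap]; split; first by rewrite linearZ /= As.
by move=> x; rewrite -/(quad _ _) quadZ; apply: mulr_ge0 => //; exact: Ap.
Qed.

Lemma pdmxZ n c (A : 'M[R]_n) : 0 < c -> pdmx A -> pdmx (c *: A).
Proof.
move=> c0 [As Ap]; split; first by rewrite linearZ /= As.
by move=> x x0; rewrite -/(quad _ _) quadZ; apply: mulr_gt0 => //; exact: Ap.
Qed.

Lemma pdmxD n (A B : 'M[R]_n) : pdmx A -> psdmx B -> pdmx (A + B).
Proof.
move=> [As Ap] [Bs Bp]; split; first by rewrite linearD /= As Bs.
by move=> x x0; rewrite -/(quad _ _) quadD; apply: ltr_wpDr; [exact: Bp | exact: Ap].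
Qed.

Lemma pdmx1 n : pdmx (1%:M : 'M[R]_n).
Proof. by split; [rewrite trmx1 | exact: quad1_gt0]. Qed.

Lemma pdmx_congr n (A C : 'M[R]_n) :
  C \in unitmx -> pdmx A -> pdmx (C^T *m A *m C).
Proof.
move=> uC [As Ap]; split; first by rewrite !trmx_mul trmxK As mulmxA.
move=> x x0; rewrite -/(quad _ _) quad_congr; apply: Ap.
by apply: contra x0 => /eqP/(congr1 (mulmx (invmx C))); rewrite mulKmx// mulmx0 => ->.
Qed.

Lemma psdmx_congr n (A C : 'M[R]_n) : psdmx A -> psdmx (C^T *m A *m C).
Proof.
move=> [As Ap]; split; first by rewrite !trmx_mul trmxK As mulmxA.
by move=> x; rewrite -/(quad _ _) quad_congr; apply: Ap.
Qed.

Lemma psdmx_trace_ge0 n (A : 'M[R]_n) : psdmx A -> 0 <= \tr A.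
Proof. by move=> [_ Ap]; apply: sumr_ge0 => i _; rewrite -quad_delta; apply: Ap. Qed.

(** * Schur complements and the Cholesky factorisation *)

(** Symmetric matrices in the shape on which the inductions on the size run. *)
Lemma symmx_block n (A : 'M[R]_n.+1) : A^T = A ->
  exists a (v : 'cV[R]_n) (B : 'M[R]_n),
    A = block_mx a%:M v^T v B :> 'M_(1 + n) /\ B^T = B.
Proof.
move=> As; pose A' : 'M_(1 + n) := A.
have Es : A'^T = A' by [].
exists (A' 0 0), (dlsubmx A'), (drsubmx A'); split; last by rewrite trmx_drsub Es.
rewrite -[LHS](@submxK _ 1 n 1 n); congr block_mx; last by rewrite trmx_dlsub Es.
by rewrite [LHS]mx11_scalar !mxE; congr ((A' _ _)%:M); apply/val_inj.
Qed.

Lemma quad_block n a (v x : 'cV[R]_n) (B : 'M[R]_n) t :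
  quad (block_mx a%:M v^T v B : 'M_(1 + n)) (col_mx t%:M x) =
  a * t ^+ 2 + 2 * t * (v^T *m x) 0 0 + quad B x.
Proof.
rewrite /quad tr_col_mx tr_scalar_mx mul_row_block mul_row_col.
rewrite !mulmxDl !mul_scalar_mx -!scalemxAl !mul_mx_scalar.
have -> : x^T *m v = v^T *m x.
  by rewrite [LHS]mx11_scalar dotmxC -mx11_scalar.
rewrite !mxE eqxx mulr1n; ring.
Qed.

Lemma det_block_schur n a (v : 'cV[R]_n) (B : 'M[R]_n) : a != 0 ->
  \det (block_mx a%:M v^T v B : 'M_(1 + n)) = a * \det (B - a^-1 *: (v *m v^T)).
Proof.
move=> a0.
have -> : block_mx a%:M v^T v B =
    block_mx 1%:M 0 (a^-1 *: v) 1%:M *m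
    block_mx a%:M v^T 0 (B - a^-1 *: (v *m v^T)) :> 'M_(1 + n).
  rewrite mulmx_block !mul1mx !mul0mx !addr0 mul_mx_scalar scalerA mulfV//.
  by rewrite scale1r -scalemxAl addrC subrK.
by rewrite det_mulmx det_lblock !det1 !mul1r det_ublock det_scalar1.
Qed.

Lemma symmx_schur n c (v : 'cV[R]_n) (B : 'M[R]_n) :
  B^T = B -> (B - c *: (v *m v^T))^T = B - c *: (v *m v^T).
Proof. by move=> Bs; rewrite linearB linearZ /= trmx_mul trmxK Bs. Qed.

Lemma quad_schur n c (v x : 'cV[R]_n) (B : 'M[R]_n) :
  quad (B - c *: (v *m v^T)) x = quad B x - c * (v^T *m x) 0 0 ^+ 2.
Proof. by rewrite -scaleNr quadD quadZ quad_outer mulNr. Qed.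

(** Minimizing the quadratic form over the first coordinate, at
    [t = - a^-1 * (v^T *m x) 0 0], leaves the form of the Schur complement. *)
Lemma pdmx_block n a (v : 'cV[R]_n) (B : 'M[R]_n) : B^T = B ->
  pdmx (block_mx a%:M v^T v B : 'M_(1 + n)) ->
  0 < a /\ pdmx (B - a^-1 *: (v *m v^T)).
Proof.
move=> Bs [_ Ap].
have {}Ap t x : col_mx t%:M x != 0 :> 'cV_(1 + n) ->
    0 < a * t ^+ 2 + 2 * t * (v^T *m x) 0 0 + quad B x.
  by move/Ap; rewrite -/(quad _ _) quad_block.
have a0 : 0 < a.
  have := Ap 1 0; rewrite mulmx0 /quad mulmx0 !mxE !mulr0 !addr0 expr1n mulr1; apply.
  apply/eqP => /(congr1 (fun x : 'cV_(1 + n) => usubmx x 0 0)) /eqP.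
  by rewrite col_mxKu !mxE oner_eq0.
split=> //; split=> [|x x0]; first exact: symmx_schur.
rewrite -/(quad _ _) quad_schur; set s := (_ *m _) 0 0.
have := Ap (- a^-1 * s) x; rewrite -/s.
have -> : a * (- a^-1 * s) ^+ 2 + 2 * (- a^-1 * s) * s = - (a^-1 * s ^+ 2).
  by field; rewrite gt_eqF.
rewrite addrC; apply; apply: contra x0 => /eqP E.
by rewrite -(col_mxKd (- a^-1 * s)%:M x) E linear0.
Qed.

(** The positive diagonal makes [\det A] the square of a positive product, and
    thereby a product of squares of diagonal entries of [U]. *)
Lemma cholesky n (A : 'M[R]_n) : pdmx A ->
  exists U : 'M[R]_n, [/\ is_trig_mx U, forall i, 0 < U i i & A = U *m U^T].
Proof.
elim: n A => [A _|n IH A Ap].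
  exists 0; split; [exact: mx0_is_trig | by case |].
  by apply/matrixP; case.
have [a [v [B [EA Bs]]]] := symmx_block Ap.1; subst A.
have [a0 /IH[U [Ut Up EU]]] := pdmx_block Bs Ap.
pose r := Num.sqrt a.
have r0 : 0 < r by rewrite sqrtr_gt0.
have rr : r * r = a by rewrite -expr2 sqr_sqrtr// ltW.
pose V : 'M_(1 + n) := block_mx r%:M 0 (r^-1 *: v) U.
have Vt : is_trig_mx V by rewrite is_trig_block_mx// eqxx scalar_mx_is_trig Ut.
have Vp i : 0 < V i i.
  by case: (split_ordP i) => k ->; rewrite ?block_mxEul ?block_mxEdr// ord1 mxE eqxx.
exists V; split=> //.
have -> : block_mx a%:M v^T v B = V *m V^T; last by [].
rewrite /V tr_block_mx mulmx_block trmx0 !mul0mx !mulmx0 !addr0 tr_scalar_mx.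
rewrite -scalar_mxM rr linearZ /= mul_scalar_mx mul_mx_scalar !scalerA mulfV ?gt_eqF//.
by rewrite !scale1r -scalemxAl -scalemxAr scalerA -invfM rr -EU addrC subrK.
Qed.

(** * The log-determinant *)

Lemma det_cholesky_gt0 n (U : 'M[R]_n) :
  is_trig_mx U -> (forall i, 0 < U i i) -> 0 < \det U.
Proof. by move=> Ut Up; rewrite det_trig// prodr_gt0. Qed.

Lemma pdmx_factor n (A : 'M[R]_n) : pdmx A ->
  exists2 C : 'M[R]_n, C \in unitmx & A = C^T *m C.
Proof.
move=> /cholesky[U [Ut Up ->]]; exists U^T; last by rewrite trmxK.
by rewrite unitmx_tr unitmxE unitfE gt_eqF// det_cholesky_gt0.
Qed.

Lemma invmx_gram n (C : 'M[R]_n) : C \in unitmx ->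
  invmx (C^T *m C) = invmx C *m (invmx C)^T.
Proof.
move=> uC; have uB : C^T *m C \in unitmx by rewrite unitmx_mul unitmx_tr uC.
apply: (can_inj (mulmxK uB)); rewrite mulVmx// -mulmxA [_ *m (_ *m C)]mulmxA.
by rewrite -trmx_mul mulmxV// trmx1 mul1mx mulVmx.
Qed.

Lemma pdmx_det_gt0 n (A : 'M[R]_n) : pdmx A -> 0 < \det A.
Proof.
move=> /cholesky[U [Ut Up ->]].
by rewrite det_mulmx det_tr mulr_gt0 ?det_cholesky_gt0.
Qed.

Lemma pdmx_unit n (A : 'M[R]_n) : pdmx A -> A \in unitmx.
Proof. by move=> /pdmx_det_gt0 A0; rewrite unitmxE unitfE gt_eqF. Qed.

Lemma pdmx_inv n (A : 'M[R]_n) : pdmx A -> pdmx (invmx A).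
Proof.
move=> pA; have uA := pdmx_unit pA; have [As _] := pA.
have -> : invmx A = (invmx A)^T *m A *m invmx A.
  by rewrite trmx_inv As mulVmx// mul1mx.
by apply: pdmx_congr => //; rewrite unitmx_inv.
Qed.

Lemma psdmx_trace_mul_ge0 n (A B : 'M[R]_n) :
  pdmx A -> psdmx B -> 0 <= \tr (A *m B).
Proof.
move=> /pdmx_factor[C uC ->] pB.
rewrite -mulmxA mxtrace_mulC -{1}(trmxK C).
exact/psdmx_trace_ge0/psdmx_congr.
Qed.

Lemma ln_ge_1BV (x : R) : 0 < x -> 1 - x^-1 <= ln x.
Proof.
move=> x0; rewrite -[x in ln x]invrK lnV ?posrE ?invr_gt0//.
have := @le_ln1Dx R (x^-1 - 1); rewrite addrCA subrr addr0 => /(_ _).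
have : 0 < x^-1 by rewrite invr_gt0.
by move=> h /(_ ltac:(lra)); lra.
Qed.

Lemma ln_prod (I : finType) (F : I -> R) :
  (forall i, 0 < F i) -> ln (\prod_i F i) = \sum_i ln (F i).
Proof.
move=> F0; suff [] : 0 < \prod_i F i /\ ln (\prod_i F i) = \sum_i ln (F i) by [].
apply: (big_rec2 (fun x y => 0 < x /\ ln x = y)); first by rewrite ln1.
by move=> i y x _ [x0 <-]; rewrite lnM ?posrE ?F0//; split=> //; exact: mulr_gt0.
Qed.

(** With A = U U^T, ln det A is the sum of the ln (U_ii^2) <= U_ii^2 - 1, while
    tr A is the sum of the squares of all the entries of U. *)
Lemma ln_det_le_trace n (A : 'M[R]_n) : pdmx A -> ln (\det A) <= \tr A - n%:R.
Proof.
move=> /cholesky[U [Ut Up ->]].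
rewrite det_mulmx det_tr det_trig// -big_split /= ln_prod => [|i]; last exact: mulr_gt0.
have -> : n%:R = \sum_(i < n) 1 :> R by rewrite sumr_const card_ord.
rewrite -sumrB; apply: ler_sum => i _.
have ui : 0 < U i i * U i i by exact: mulr_gt0.
have := @le_ln1Dx R (U i i * U i i - 1); rewrite addrCA subrr addr0.
move/(_ ltac:(lra))/le_trans; apply.
rewrite lerB// mxE (bigD1 i)//= mxE lerDl; apply: sumr_ge0 => j _.
by rewrite mxE -expr2 sqr_ge0.
Qed.

(** Concavity of ln det, as the tangent inequality at B: for B = C^T C it is
    [ln_det_le_trace] at the congruent matrix C^-T A C^-1. *)
Lemma ln_det_tangent n (A B : 'M[R]_n) : pdmx A -> pdmx B ->
  ln (\det A) - ln (\det B) <= \tr (invmx B *m (A - B)).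
Proof.
move=> pA pB; have [C uC EB] := pdmx_factor pB.
have uD : invmx C \in unitmx by rewrite unitmx_inv.
have := ln_det_le_trace (pdmx_congr uD pA).
have -> : \tr ((invmx C)^T *m A *m invmx C) = \tr (invmx B *m A).
  by rewrite mxtrace_mulC mulmxA EB invmx_gram.
rewrite mulmxBr mulVmx ?pdmx_unit// linearB /= mxtrace1; apply: le_trans.
have -> : \det ((invmx C)^T *m A *m invmx C) = \det A / \det B.
  rewrite EB !det_mulmx !det_tr !det_inv invfM; ring.
by rewrite ln_div ?posrE ?pdmx_det_gt0.
Qed.

Lemma pdmxD_quarter n (A S : 'M[R]_n) : pdmx A -> psdmx (A + 4 *: S) -> pdmx (A + S).
Proof.
move=> Ap ASp; have -> : A + S = (3 / 4) *: A + (1 / 4) *: (A + 4 *: S).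
  rewrite scalerDr addrA -scalerDl scalerA.
  by congr (_ + _); rewrite -[LHS]scale1r; congr (_ *: _); field.
apply: pdmxD; [apply: pdmxZ Ap | apply: psdmxZ ASp]; lra.
Qed.

(** If a is the corner of Y, v the column below it and B the remaining block,
    the Schur complement of 1 + Y is 1 + Y' with Y' = B - (1 + a)^-1 v v^T, and Y'
    again satisfies Y' >= - 1/4, so the induction hypothesis applies to it.  The
    terms in v then balance because the quadratic form of B at v is controlled
    through Y' >= - 1/4.  The factor 4 in the hypothesis ensures
    1 + a >= 3/4, which keeps their coefficient within the 4 |v|^2 that comes from
    2 tr (Y^2). *)
Lemma ln_det1D_quadratic n (Y : 'M[R]_n) : Y^T = Y -> psdmx (1%:M + 4 *: Y) ->
  \tr Y - 2 * \tr (Y *m Y) <= ln (\det (1%:M + Y)).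
Proof.
move=> Ys Yp.
elim: n Y Ys Yp => [Y _ _|n IH Y Ys Yp].
  by rewrite det_mx00 ln1 /mxtrace !big_ord0 mulr0 subr0.
have [a [v [B [EY Bs]]]] := symmx_block Ys; subst Y.
set Y := block_mx _ _ _ _ in Ys Yp *.
have {Yp} Yp t x : 0 <= (1 + 4 * a) * t ^+ 2 + 8 * t * (v^T *m x) 0 0 +
    (quad 1%:M x + 4 * quad B x).
  have := Yp.2 (col_mx t%:M x); rewrite -/(quad _ _) quadD quadZ /Y.
  have -> : 1%:M = block_mx 1%:M (0 : 'cV_n)^T 0 1%:M :> 'M[R]_(1 + n).
    by rewrite trmx0 -scalar_mx_block.
  by rewrite !quad_block trmx0 mul0mx mxE => h; apply: le_trans h _; lra.
have a0 : 0 <= 1 + 4 * a.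
  have := Yp 1 0; rewrite /quad !mulmx0 !mxE; lra.
pose c := (1 + a)^-1; pose Y' := B - c *: (v *m v^T).
have c0 : 0 < c by rewrite invr_gt0; lra.
have ca : c * (1 + a) = 1 by rewrite mulVf// gt_eqF//; lra.
have Y'p x : 0 <= quad 1%:M x + 4 * quad Y' x.
  rewrite /Y' quad_schur; set s := (_ *m _) 0 0.
  (* This test vector minimizes the quadratic form of 1 + Y over the first
     coordinate. *)
  have := Yp (- c * s) x; rewrite -/s => h.
  have e : c ^+ 2 * (1 + a) * s ^+ 2 = c * s ^+ 2.
    by rewrite expr2 -(mulrA c c) ca mulr1.
  have : 0 <= c ^+ 2 * s ^+ 2 by rewrite mulr_ge0 ?sqr_ge0.
  move: h e; lra.
have {IH} := IH Y' (symmx_schur _ _ Bs).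
have psdY' : psdmx (1%:M + 4 *: Y').
  split=> [|x]; first by rewrite linearD linearZ /= trmx1 symmx_schur.
  by rewrite -/(quad _ _) quadD quadZ.
move/(_ psdY').
set q := quad 1%:M v.
have q0 : 0 <= q by rewrite /q quad1; apply: sumr_ge0 => i _; exact: sqr_ge0.
have vv : (v^T *m v) 0 0 = q by rewrite /q /quad mulmx1.
have trvv : \tr (v *m v^T) = q by rewrite mxtrace_mulC /mxtrace big_ord1.
have trBvv : \tr (B *m (v *m v^T)) = quad B v.
  by rewrite mulmxA mxtrace_mulC mulmxA /mxtrace big_ord1.
have -> : \tr Y' = \tr B - c * q by rewrite linearB linearZ /= trvv.
have -> : \tr (Y' *m Y') = \tr (B *m B) - 2 * c * quad B v + c ^+ 2 * q ^+ 2.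
  rewrite mulmxBl !mulmxBr -!scalemxAl -!scalemxAr !linearB !linearZ /=.
  rewrite [\tr (v *m v^T *m B)]mxtrace_mulC trBvv.
  have -> : \tr (v *m v^T *m (v *m v^T)) = q ^+ 2.
    rewrite mulmxA -(mulmxA v) [v^T *m v]mx11_scalar vv mul_mx_scalar -scalemxAl.
    by rewrite linearZ /= trvv expr2.
  ring.
have -> : \tr Y = a + \tr B by rewrite mxtrace_block mxtrace_scalar.
have -> : \tr (Y *m Y) = a ^+ 2 + 2 * q + \tr (B *m B).
  rewrite mulmx_block mxtrace_block !linearD /= trvv -scalar_mxM mxtrace_scalar.
  by rewrite [\tr (v^T *m v)]mxtrace_mulC trvv; ring.
have -> : \det (1%:M + Y) = (1 + a) * \det (1%:M + Y').
  have -> : 1%:M + Y = block_mx (1 + a)%:M v^T v (1%:M + B) :> 'M_(1 + n).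
    by rewrite scalar_mx_block add_block_mx !add0r -raddfD.
  by rewrite det_block_schur ?gt_eqF//; [rewrite -/c /Y' addrA | lra].
(* Y' >= - 1/4 at v, written in terms of B. *)
have hB : - (q / 4) <= quad B v - c * q ^+ 2.
  have := Y'p v; rewrite quad_schur vv -/q; lra.
have : a - 2 * a ^+ 2 <= ln (1 + a).
  apply: le_trans (@ln_ge_1BV (1 + a) _); last lra.
  by rewrite -/c; nra.
have pY' : 0 < \det (1%:M + Y') by apply/pdmx_det_gt0/(pdmxD_quarter (pdmx1 _)).
rewrite lnM ?posrE//; last lra.
have cq : c * q <= 4 / 3 * q by apply: ler_wpM2r => //; nra.
have := @ler_wpM2l R (4 * c) _ _ _ hB.
nra.
Qed.

(** The general point A reduces to the identity by a congruence with a Cholesky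
    factor of A. *)
Lemma ln_det_quadratic n (A S : 'M[R]_n) : pdmx A -> S^T = S ->
  psdmx (A + 4 *: S) ->
  \tr (invmx A *m S) - 2 * \tr (invmx A *m S *m (invmx A *m S)) <=
    ln (\det (A + S)) - ln (\det A).
Proof.
move=> pA Ss pAS; have [C uC EA] := pdmx_factor pA.
set D := invmx C; have uD : D \in unitmx by rewrite unitmx_inv.
have EV : invmx A = D *m D^T by rewrite EA invmx_gram.
have DA : D^T *m A *m D = 1%:M.
  by rewrite EA !mulmxA -trmx_mul mulmxV// trmx1 mul1mx mulmxV.
pose Y := D^T *m S *m D.
have Ys : Y^T = Y by rewrite /Y !trmx_mul trmxK Ss mulmxA.
have := @psdmx_congr _ _ D pAS.
rewrite mulmxDr mulmxDl DA -scalemxAr -scalemxAl -/Y => pY.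
have := ln_det1D_quadratic Ys pY.
have -> : \tr Y = \tr (invmx A *m S) by rewrite /Y EV mxtrace_mulC !mulmxA.
have -> : \tr (Y *m Y) = \tr (invmx A *m S *m (invmx A *m S)).
  by rewrite /Y EV -!mulmxA mxtrace_mulC -!mulmxA mxtrace_mulC -!mulmxA.
rewrite -ln_div ?posrE ?pdmx_det_gt0//; last exact: pdmxD_quarter.
have -> // : \det (1%:M + Y) = \det (A + S) / \det A.
rewrite -DA -mulmxDl -mulmxDr EA !det_mulmx !det_tr det_inv invfM; ring.
Qed.

(** * Log-determinant estimates for one round *)

(** Variational inequality for a minimizer A of - ln det plus a linear form whose
    increment from A to B is s.  The quadratic bound replaces differentiability:
    after division by the step l, its error term is linear in l. *)
Lemma first_order_optimality n (A B : 'M[R]_n) (s : R) : pdmx A -> pdmx B ->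
  (forall l, 0 < l <= 1 ->
     ln (\det (A + l *: (B - A))) - ln (\det A) <= l * s) ->
  \tr (invmx A *m (B - A)) <= s.
Proof.
move=> pA pB opt; set S := B - A.
have Ss : S^T = S by rewrite /S linearB /= pA.1 pB.1.
set p := \tr (invmx A *m S); set q := \tr (invmx A *m S *m (invmx A *m S)).
have slope l : 0 < l <= 1 / 4 -> p - 2 * l * q <= s.
  move=> /andP[l0 l1]; have := opt l; rewrite l0 => /(_ ltac:(lra)).
  have lSs : (l *: S)^T = l *: S by rewrite linearZ /= Ss.
  have pAS : psdmx (A + 4 *: (l *: S)).
    have -> : A + 4 *: (l *: S) = (1 - 4 * l) *: A + (4 * l) *: B.
      by rewrite /S scalerA scalerBr scalerBl scale1r addrAC addrA.
    by apply: psdmxD; apply: psdmxZ; first [exact: pdmx_psd | lra].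
  move/(le_trans (ln_det_quadratic pA lSs pAS)).
  rewrite -!scalemxAr -scalemxAl !linearZ /= -/p -/q => h.
  by rewrite -(ler_pM2l l0); apply: le_trans h; lra.
rewrite leNgt; apply/negP => sp.
(* A violation by d is refuted at a step d / m: m >= 4 d makes the step at most
   1/4, and m >= 4 |q| makes the error term at most d / 2. *)
pose d := p - s; pose m := 4 * (d + `|q|).
have d0 : 0 < d by rewrite subr_gt0.
have qn := ler_norm q; have q0 := normr_ge0 q.
have m0 : 0 < m by rewrite /m; lra.
have := slope (d / m); rewrite divr_gt0//= => /(_ _) h.
have dm : d / m <= 1 / 4 by rewrite ler_pdivrMr// /m; lra.
have {h} := h dm.
have : 2 * (d / m) * q < d.
  rewrite mulrA mulrAC ltr_pdivrMr// /m; nra.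
rewrite /d; lra.
Qed.

(** The right-hand side is least, over all positive definite B, at the inverse of
    [invmx A + eta *: L]; the tangent bound there disposes of B. *)
Lemma logdet_stability n (A B L : 'M[R]_n) (eta : R) :
  pdmx A -> pdmx B -> psdmx L -> 0 < eta ->
  - (2 * eta ^+ 2 * \tr (A *m L *m (A *m L))) <=
  ln (\det A) - ln (\det B) + \tr (invmx A *m (B - A)) + eta * \tr (L *m (B - A)).
Proof.
move=> pA pB pL eta0; have pIA := pdmx_inv pA.
have peL : psdmx (eta *: L) by apply: psdmxZ (ltW eta0) pL.
pose H := invmx A + eta *: L.
have pH : pdmx H by exact: pdmxD.
have uH := pdmx_unit pH.
have := ln_det_tangent pB (pdmx_inv pH).
rewrite invmxK mulmxBr mulmxV// linearB /= mxtrace1 det_inv.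
have pAL : psdmx (invmx A + 4 *: (eta *: L)).
  apply: psdmxD; [exact: pdmx_psd | exact: psdmxZ].
have := ln_det_quadratic pIA peL.1 pAL.
rewrite -/H invmxK det_inv !lnV ?posrE ?pdmx_det_gt0//.
rewrite -!scalemxAr -scalemxAl !linearZ /=.
have -> : \tr (H *m B) = \tr (invmx A *m (B - A)) + n%:R + eta * \tr (L *m (B - A)) + eta * \tr (A *m L).
  rewrite /H mulmxDl -scalemxAl !mulmxBr mulVmx ?pdmx_unit// !linearD /= !linearN /= mxtrace1.
  rewrite linearZ /= (mxtrace_mulC L A); ring.
move=> h1 h2; lra.
Qed.

(** Each entry of A L is at most b times the corresponding column sum of |L|. *)
Lemma trace_mul_sqr_le n (A L : 'M[R]_n) (b g : R) : 0 <= b ->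
  (forall i j, `|A i j| <= b) -> \sum_i \sum_j `|L i j| <= g ->
  \tr (A *m L *m (A *m L)) <= b ^+ 2 * g ^+ 2.
Proof.
move=> b0 Ab Lg.
have AL i j : `|(A *m L) i j| <= b * \sum_k `|L k j|.
  rewrite mxE; apply: le_trans (ler_norm_sum _ _ _) _.
  by rewrite mulr_sumr; apply: ler_sum => k _; rewrite normrM ler_wpM2r.
set c := fun j => \sum_k `|L k j| in AL.
have c0 j : 0 <= c j by exact: sumr_ge0.
have cg : \sum_j c j <= g by rewrite exchange_big.
apply: (@le_trans _ _ (\sum_i \sum_j (b * c j) * (b * c i))).
  apply: ler_sum => i _; rewrite mxE; apply: ler_sum => j _.
  apply: le_trans (ler_norm _) _; rewrite normrM.
  by apply: ler_pM => //; exact: AL.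
have -> : \sum_i \sum_j (b * c j) * (b * c i) = b ^+ 2 * (\sum_j c j) ^+ 2.
  rewrite -exprMn mulr_sumr expr2 mulr_suml; apply: eq_bigr => i _.
  by rewrite mulr_sumr; apply: eq_bigr => j _; rewrite mulrC.
apply: ler_wpM2l; first exact: sqr_ge0.
have x0 : 0 <= \sum_j c j by exact: sumr_ge0.
by rewrite ler_sqr ?nnegrE//; apply: le_trans cg.
Qed.

(** * The feasible set and the losses *)

Lemma entry_le_mx_norm n (A : 'M[R]_n) i j : `|A i j| <= mx_norm A.
Proof. by rewrite mx_normrE; exact: (le_bigmax _ (fun ij => `|A ij.1 ij.2|) (i, j)). Qed.

Lemma mx_norm_ge0 n (A : 'M[R]_n) : 0 <= mx_norm A.
Proof. by rewrite mx_normrE; exact: bigmax_ge_id. Qed.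

Lemma mx_normZ n c (A : 'M[R]_n) : 0 <= c -> mx_norm (c *: A) <= c * mx_norm A.
Proof.
move=> c0; rewrite mx_normrE; apply/bigmax_leP; split => [|[i j] _] /=.
  by rewrite mulr_ge0 ?mx_norm_ge0.
by rewrite mxE normrM ger0_norm// ler_wpM2l ?entry_le_mx_norm.
Qed.

Lemma frobenius_trace n (A B : 'M[R]_n) : B^T = B -> frobenius A B = \tr (A *m B).
Proof.
move=> Bs; apply: eq_bigr => i _; rewrite mxE; apply: eq_bigr => j _.
by rewrite -[in RHS]Bs mxE.
Qed.

Lemma feasible_convex n (Gamma : 'M[R]_n) beta tau V W l : 0 < l <= 1 ->
  feasible Gamma beta tau W -> feasible Gamma beta tau V ->
  feasible Gamma beta tau (W + l *: (V - W)).
Proof.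
move=> /andP[l0 l1] [pW nW tW] [pV nV tV].
have l1' : 0 <= 1 - l by lra.
have -> : W + l *: (V - W) = l *: V + (1 - l) *: W.
  by rewrite scalerBr scalerBl scale1r addrCA addrA.
split.
- by apply: pdmxD (pdmxZ l0 pV) (psdmxZ l1' (pdmx_psd pW)).
- apply: le_trans (ler_mx_norm_add _ _) _.
  have := mx_normZ V (ltW l0); have := mx_normZ W l1'.
  nra.
- rewrite mulmxDr mulmxDl linearD /= -!scalemxAr -!scalemxAl !linearZ /=.
  nra.
Qed.

(** * Regret of follow-the-regularized-leader *)

(** The hypothesis says that the objective including the loss of round t is on K
    at least its value at W_t, minus c.  By induction on the rounds this value can
    be traced back to the regularizer at W_1: the inequality of round t is
    used at V = W_(t+1), and that of the last round at the competitor.  Thus no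
    minimizer after round T is involved. *)
Lemma ftrl_regret_le n (K : set 'M[R]_n) reg eta T L W Wstar c :
  0 < eta -> (0 < T)%N -> FTRL K reg eta T L W -> K Wstar ->
  (forall t V, (1 <= t <= T)%N -> K V ->
     reg (W t) + eta * \sum_(1 <= s < t) frobenius (L s) (W t) - c <=
     reg V + eta * \sum_(1 <= s < t) frobenius (L s) V
       + eta * (frobenius (L t) V - frobenius (L t) (W t))) ->
  regret T L W Wstar <= (reg Wstar - reg (W 1)) / eta + T%:R * c / eta.
Proof.
move=> eta0 T0 ftrl Ks step.
have : forall m V, (m <= T)%N -> K V ->
    reg (W 1) + eta * \sum_(1 <= s < m.+1) frobenius (L s) (W s) - m%:R * c <=
    reg V + eta * \sum_(1 <= s < m.+1) frobenius (L s) V.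
  elim=> [|m IH] V mT KV.
    have [_ /(_ _ KV)] := ftrl 1 T0.
    by rewrite !big_nil !mulr0 mul0r subr0.
  have [KW _] := ftrl m.+1 mT.
  have := IH _ (ltnW mT) KW; have := step m.+1 V mT KV.
  rewrite ![\sum_(1 <= s < m.+2) _]big_nat_recr//= -[in m.+1%:R]addn1 natrD.
  lra.
move=> /(_ T Wstar (leqnn _) Ks) h.
have -> : regret T L W Wstar = \sum_(1 <= s < T.+1) frobenius (L s) (W s)
    - \sum_(1 <= s < T.+1) frobenius (L s) Wstar.
  rewrite -sumrB; apply: eq_bigr => t _; rewrite /frobenius -sumrB.
  apply: eq_bigr => i _; rewrite -sumrB; apply: eq_bigr => j _.
  by rewrite !mxE; ring.
rewrite -mulrDl ler_pdivlMr//; lra.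
Qed.

(** Comparing both values of ln det with the one at [eps%:M]: the point W exceeds
    it by at most tr (Gamma W Gamma) / eps, and V does not fall below it. *)
Lemma logdet_diameter n (Gamma V W : 'M[R]_n) eps tau : 0 < eps -> pdmx Gamma ->
  pdmx V -> pdmx W -> \tr (Gamma *m W *m Gamma) <= tau ->
  logdet_reg Gamma eps V - logdet_reg Gamma eps W <= tau / eps.
Proof.
move=> e0 pG pV pW tW.
have conj Z : pdmx Z -> pdmx (Gamma *m Z *m Gamma).
  by move=> pZ; rewrite -[X in X *m Z]pG.1; apply: pdmx_congr (pdmx_unit pG) pZ.
have pe : pdmx (eps%:M : 'M[R]_n) by rewrite -scalemx1; apply: pdmxZ e0 (pdmx1 _).
have reg Z : pdmx Z -> pdmx (Gamma *m Z *m Gamma + eps%:M).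
  by move=> pZ; apply: pdmxD (conj _ pZ) (pdmx_psd pe).
have := ln_det_tangent (reg _ pW) pe.
have := ln_det_tangent pe (reg _ pV).
rewrite addrK invmx_scalar mul_scalar_mx linearZ /= opprD addrCA subrr addr0 mulmxN linearN /=.
have := psdmx_trace_mul_ge0 (pdmx_inv (reg _ pV)) (pdmx_psd (conj _ pV)).
have : eps^-1 * \tr (Gamma *m W *m Gamma) <= tau / eps.
  by rewrite mulrC ler_pM2r ?invr_gt0.
rewrite /logdet_reg; lra.
Qed.

Lemma frobenius_segment n (L V W : 'M[R]_n) l :
  frobenius L (W + l *: (V - W)) =
  frobenius L W + l * (frobenius L V - frobenius L W).
Proof.
rewrite /frobenius -sumrB mulr_sumr -big_split; apply: eq_bigr => i _ /=.
rewrite -sumrB mulr_sumr -big_split; apply: eq_bigr => j _ /=.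
by rewrite !mxE; ring.
Qed.

(** Conjugation by Gamma changes ln det by a constant, so the regularizer behaves
    as - ln det of the shifted matrix S, whose entries are bounded on the feasible
    set. *)
Lemma logdet_reg_shift n (Gamma V : 'M[R]_n) eps : 0 <= eps ->
  pdmx Gamma -> pdmx V ->
  let S := V + eps *: (invmx Gamma *m invmx Gamma) in
  pdmx S /\ logdet_reg Gamma eps V = - ln (\det S) - 2 * ln (\det Gamma).
Proof.
move=> e0 pG pV S; have uG := pdmx_unit pG.
have pS : pdmx S.
  apply: pdmxD pV (psdmxZ e0 (pdmx_psd _)).
  rewrite -[X in X *m _](pdmx_inv pG).1 -[X in _ *m X]mul1mx mulmxA.
  by apply: pdmx_congr (pdmx1 _); rewrite unitmx_inv.
split=> //; rewrite /logdet_reg.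
have -> : Gamma *m V *m Gamma + eps%:M = Gamma *m S *m Gamma.
  rewrite /S mulmxDr mulmxDl -scalemxAr -scalemxAl mulmxA mulmxV// mul1mx.
  by rewrite mulVmx// scalemx1.
have G0 := pdmx_det_gt0 pG; have S0 := pdmx_det_gt0 pS.
by rewrite !det_mulmx !lnM ?posrE ?mulr_gt0//; ring.
Qed.

(** The step size at which the two terms of the regret bound coincide. *)
Lemma balanced_step (x y : R) : 0 < x -> 0 < y ->
  x * Num.sqrt (y / x) = Num.sqrt (x * y) /\
  y / Num.sqrt (y / x) = Num.sqrt (x * y).
Proof.
move=> x0 y0; have yx : 0 < y / x by exact: divr_gt0.
have e : x * Num.sqrt (y / x) = Num.sqrt (x * y).
  have -> : x * y = x ^+ 2 * (y / x) by field; rewrite gt_eqF.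
  by rewrite [in RHS]sqrtrM ?sqr_ge0// sqrtr_sqr gtr0_norm.
split=> //; have s0 : 0 < Num.sqrt (y / x) by rewrite sqrtr_gt0.
apply: (@mulIf _ (Num.sqrt (y / x))); first by rewrite gt_eqF.
rewrite mulfVK ?gt_eqF// -e -mulrA -expr2 sqr_sqrtr ?ltW//.
by field; rewrite gt_eqF.
Qed.

(** The cost of one round, in the form that [ftrl_regret_le] consumes: the
    first-order condition at W turns the past losses into the trace term of
    [logdet_stability]. *)
Lemma ftrl_logdet_step n (Gamma : 'M[R]_n) beta tau g eps eta
    (Ls : seq 'M[R]_n) (L W V : 'M[R]_n) :
  let rho := mx_norm (invmx Gamma *m invmx Gamma) in
  let K := feasible Gamma beta tau in
  pdmx Gamma -> 0 < eps -> 0 < eta -> losses g L ->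
  argmin K (fun X => logdet_reg Gamma eps X + eta * \sum_(M <- Ls) frobenius M X) W ->
  K V ->
  logdet_reg Gamma eps W + eta * \sum_(M <- Ls) frobenius M W
    - 2 * eta ^+ 2 * ((beta + rho * eps) ^+ 2 * g ^+ 2) <=
  logdet_reg Gamma eps V + eta * \sum_(M <- Ls) frobenius M V
    + eta * (frobenius L V - frobenius L W).
Proof.
move=> rho K pG e0 eta0 [pL Lg] [KW minW] KV.
have [pW nW _] := KW; have [pV nV _] := KV.
have [pA regW] := logdet_reg_shift (ltW e0) pG pW.
have [pB regV] := logdet_reg_shift (ltW e0) pG pV.
set G := invmx Gamma *m invmx Gamma in rho pA regW pB regV *.
have BA : V + eps *: G - (W + eps *: G) = V - W by rewrite opprD addrACA subrr addr0.
pose s := \sum_(M <- Ls) frobenius M V - \sum_(M <- Ls) frobenius M W.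
have opt : \tr (invmx (W + eps *: G) *m (V - W)) <= eta * s.
  rewrite -BA; apply: first_order_optimality pA pB _ => l l01; rewrite BA.
  have KU := feasible_convex l01 KW KV; have [pU _ _] := KU.
  have [_] := logdet_reg_shift (ltW e0) pG pU; rewrite addrAC -/G => regU.
  have := minW _ KU; rewrite regU regW.
  under [X in _ <= _ + eta * X]eq_bigr do rewrite frobenius_segment.
  rewrite big_split /= -mulr_sumr sumrB /s; lra.
have := logdet_stability pA pB pL eta0; rewrite BA.
have := @trace_mul_sqr_le _ (W + eps *: G) L (beta + rho * eps) g.
have -> : \tr (L *m (V - W)) = frobenius L V - frobenius L W.
  by rewrite (frobenius_trace _ pV.1) (frobenius_trace _ pW.1) mulmxBr linearB.
have Wb : forall i j, `|(W + eps *: G) i j| <= beta + rho * eps.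
  move=> i j; apply: le_trans (entry_le_mx_norm _ _ _) _.
  apply: le_trans (ler_mx_norm_add _ _) _; apply: lerD nW _.
  by rewrite mulrC mx_normZ// ltW.
have b0 : 0 <= beta + rho * eps.
  apply: addr_ge0; first exact: le_trans (mx_norm_ge0 _) nW.
  by rewrite mulr_ge0 ?mx_norm_ge0 ?ltW.
move=> /(_ b0 Wb Lg) tr_le.
have c0 : 0 <= 2 * eta ^+ 2 by rewrite mulr_ge0 ?sqr_ge0.
have := ler_wpM2l c0 tr_le.
rewrite regW regV; move: opt; rewrite /s; lra.
Qed.

End LogDeterminant.

Theorem theorem1 (R : realType) :
  exists2 C : R, 0 < C &
  forall (N : nat) (Gamma : 'M[R]_N) (beta tau g eps eta : R) (T : nat)
    (Lset : set 'M[R]_N) (L W : nat -> 'M[R]_N) (Wstar : 'M[R]_N),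
  let rho := mx_norm (invmx Gamma *m invmx Gamma) in
  let K := feasible Gamma beta tau in
  (0 < N)%N -> pdmx Gamma ->
  0 < beta -> 0 < tau -> 0 < g -> 0 < eps -> 0 < eta -> (0 < T)%N ->
  Lset `<=` @losses R N g ->
  (forall t : nat, (1 <= t <= T)%N -> Lset (L t)) ->
  FTRL K (logdet_reg Gamma eps) eta T L W ->
  K Wstar ->
  regret T L W Wstar
    <= C * (g ^+ 2 * (beta + rho * eps) ^+ 2 * T%:R * eta + tau / (eps * eta))
  /\ (eta = Num.sqrt (tau / (g ^+ 2 * (beta + rho * eps) ^+ 2 * eps * T%:R)) ->
      regret T L W Wstar
        <= C * Num.sqrt (g ^+ 2 * (beta + rho * eps) ^+ 2 * tau * T%:R / eps)).
Proof.
exists 3; first by [].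
move=> N Gamma beta tau g eps eta T Lset L W Wstar rho K _ pG.
move=> beta0 tau0 g0 eps0 eta0 T0 Lsub LL ftrl Kstar.
have TR0 : 0 < T%:R :> R by rewrite ltr0n.
set b := beta + rho * eps.
have b0 : 0 < b by rewrite ltr_wpDr// mulr_ge0 ?mx_norm_ge0 ?ltW.
set x := g ^+ 2 * b ^+ 2 * T%:R; set y := tau / eps.
have x0 : 0 < x by rewrite !mulr_gt0 ?exprn_gt0.
have y0 : 0 < y by exact: divr_gt0.
have bound : regret T L W Wstar <= 2 * (x * eta) + y / eta.
  have KW1 : K (W 1) by apply: (ftrl 1 _).1; rewrite T0.
  have diam : logdet_reg Gamma eps Wstar - logdet_reg Gamma eps (W 1) <= y.
    have [pS _ _] := Kstar; have [pW _ tW] := KW1.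
    exact: logdet_diameter eps0 pG pS pW tW.
  apply: le_trans (ftrl_regret_le
    (c := 2 * eta ^+ 2 * (b ^+ 2 * g ^+ 2)) eta0 T0 ftrl Kstar _) _.
    move=> t V tT KV.
    have := ftrl t tT.
    have bigE X : \sum_(1 <= s < t) frobenius (L s) X =
        \sum_(M <- map L (index_iota 1 t)) frobenius M X by rewrite big_map.
    rewrite !bigE => -[KWt minW].
    apply: (ftrl_logdet_step pG eps0 eta0 (Lsub _ (LL _ tT)) _ KV).
    by split=> // Z KZ; rewrite -!bigE; exact: minW.
  have -> : T%:R * (2 * eta ^+ 2 * (b ^+ 2 * g ^+ 2)) / eta = 2 * (x * eta).
    by rewrite /x; field; rewrite gt_eqF.
  by rewrite addrC lerD2l ler_pM2r ?invr_gt0.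
have xe0 : 0 < x * eta by exact: mulr_gt0.
have ye0 : 0 < y / eta by exact: divr_gt0.
split.
  have -> : tau / (eps * eta) = y / eta by rewrite /y invfM mulrA.
  by apply: le_trans bound _; lra.
have -> : tau / (g ^+ 2 * b ^+ 2 * eps * T%:R) = y / x.
  by rewrite /x /y; field; rewrite !gt_eqF.
have -> : g ^+ 2 * b ^+ 2 * tau * T%:R / eps = x * y.
  by rewrite /x /y; field; rewrite gt_eqF.
have [e1 e2] := balanced_step x0 y0.
by move=> eE; apply: le_trans bound _; rewrite eE e1 e2; lra.
Qed.
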